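(* Let $n\in\mathbb{N}_{>0}$ and let $\pi_1,\dots,\pi_n$ be infinite-dimensional admissible irreducible representations of $G=\mathrm{GL}_2(\mathbb{Q}_p)$ over $\overline{\mathbb{F}}_p$. Then $$\operatorname{Hom}_G\Big(\bigotimes_{i=1}^n\pi_i,\mathbf{1}\Big)=0.$$
   Context: $p$ is a prime number. Representations are over $\overline{\mathbb{F}}_p$; tensor products are over $\overline{\mathbb{F}}_p$ with the diagonal $G$-action; $\mathbf{1}$ is the trivial one-dimensional representation; $\operatorname{Hom}_G$ denotes the space of $\overline{\mathbb{F}}_p$-linear $G$-equivariant maps. A representation is smooth if every vector has open stabilizer; admissible means smooth with finite-dimensional invariants under every compact open subgroup of $G$. *)

(* Defs.v *)
From HB Require Import structures.
From mathcomp Require Import all_boot all_order all_algebra all_field.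
From mathcomp Require Import generic_quotient ring_quotient.
From mathcomp Require Import all_classical topology normedtype.
From mathcomp Require Import freeg ring lra.
Set Implicit Arguments.
Unset Strict Implicit.
Unset Printing Implicit Defensive.
Import Order.TTheory GRing.Theory Num.Theory.
Local Open Scope classical_set_scope.
Local Open Scope ring_scope.

(* For p not prime [logn p] vanishes, so [padic_abs p] is the trivial absolute
   value: the construction of [Qp p] goes through without assuming p prime, and
   yields Q_p when p is prime, a copy of Q otherwise. *)
Definition padic_abs (p : nat) (x : rat) : rat :=
  if x == 0 then 0
  else p%:R ^+ logn p `|denq x|%N / p%:R ^+ logn p `|numq x|%N.

Section PadicAbs.
Variable p : nat.
Local Notation abs := (padic_abs p).
Let w (n : nat) : rat := p%:R ^+ logn p n.

Let w_gt0 n : 0 < w n.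
Proof.
rewrite /w; case: (posnP (logn p n)) => [->|]; first by rewrite expr0 ltr01.
by rewrite logn_gt0 mem_primes => /andP[/prime_gt0 p0 _]; rewrite exprn_gt0 ?ltr0n.
Qed.

Let w_neq0 n : w n != 0. Proof. by rewrite gt_eqF. Qed.

Let wM m n : (0 < m)%N -> (0 < n)%N -> w (m * n) = w m * w n.
Proof. by move=> m0 n0; rewrite /w lognM // exprD. Qed.

Let abs_frac (a b : int) : a != 0 -> b != 0 ->
  abs (a%:~R / b%:~R) = w `|b|%N / w `|a|%N.
Proof.
move=> a0 b0; rewrite /padic_abs; set x := a%:~R / b%:~R.
have x0 : x != 0 by rewrite mulf_neq0 ?invr_eq0 ?intr_eq0.
rewrite (negbTE x0) -/(w _) -/(w _).
have E : a * denq x = numq x * b.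
  apply/eqP; rewrite -(eqr_int rat) !intrM; apply/eqP.
  have /eqP := divq_num_den x.
  by rewrite eq_sym {1}/x eqr_div ?intr_eq0 ?denq_neq0 // => /eqP.
have /(congr1 w) : (`|a| * `|denq x| = `|numq x| * `|b|)%N by rewrite -!abszM E.
rewrite !wM ?absz_gt0 ?numq_eq0 ?denq_neq0 // => Ew.
by apply/eqP; rewrite eqr_div ?w_neq0 // mulrC Ew mulrC.
Qed.

Lemma padic_abs0 : abs 0 = 0. Proof. by rewrite /padic_abs eqxx. Qed.

Lemma padic_abs_ge0 x : 0 <= abs x.
Proof. by rewrite /padic_abs; case: ifP => // _; rewrite divr_ge0 ?ltW ?w_gt0. Qed.

Lemma padic_abs_eq0 x : (abs x == 0) = (x == 0).
Proof.
rewrite /padic_abs; case: (x =P 0) => [|_]; first by rewrite eqxx.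
by apply: gt_eqF; rewrite divr_gt0 ?w_gt0.
Qed.

Lemma padic_absN x : abs (- x) = abs x.
Proof. by rewrite /padic_abs oppr_eq0 denqN numqN abszN. Qed.

Lemma padic_abs1 : abs 1 = 1.
Proof. by rewrite /padic_abs oner_eq0 /= logn1 expr0 divr1. Qed.

Lemma padic_absM x y : abs (x * y) = abs x * abs y.
Proof.
case: (eqVneq x 0) => [->|x0]; first by rewrite mul0r padic_abs0 mul0r.
case: (eqVneq y 0) => [->|y0]; first by rewrite mulr0 padic_abs0 mulr0.
rewrite -[x in LHS]divq_num_den -[y in LHS]divq_num_den mulf_div -!intrM.
rewrite abs_frac ?mulf_neq0 ?numq_eq0 ?denq_neq0 // !abszM.
rewrite !wM ?absz_gt0 ?numq_eq0 ?denq_neq0 //.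
by rewrite /padic_abs (negbTE x0) (negbTE y0) mulf_div.
Qed.

Let wD (a b : int) : a != 0 -> b != 0 -> a + b != 0 ->
  (w `|a|%N <= w `|(a + b)%R|%N) || (w `|b|%N <= w `|(a + b)%R|%N).
Proof.
move=> a0 b0 ab0; rewrite /w.
have [p_pr|p_npr] := boolP (prime p); last first.
  have L n : logn p n = 0%N by rewrite lognE (negbTE p_npr).
  by rewrite !L !expr0 lexx.
have p1 : 1 <= p%:R :> rat by rewrite ler1n prime_gt0.
have key (c d : int) : (logn p `|c| <= logn p `|d|)%N -> c != 0 -> d != 0 -> c + d != 0 ->
    (p%:R ^+ logn p `|c| <= p%:R ^+ logn p `|(c + d)%R| :> rat)%R.
  move=> cd c0 d0 cd0; apply: ler_weXn2l => //.
  rewrite -pfactor_dvdn ?absz_gt0 //.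
  have hc : ((p ^ logn p `|c|)%N%:Z %| c)%Z by rewrite dvdzE /= pfactor_dvdn ?absz_gt0.
  have hd : ((p ^ logn p `|c|)%N%:Z %| d)%Z.
    by rewrite dvdzE /= pfactor_dvdn ?absz_gt0.
  by have := rpredD hc hd; rewrite dvdzE.
case: (leqP (logn p `|a|) (logn p `|b|)) => [ab|/ltnW ba].
  by rewrite key.
by apply/orP; right; rewrite (addrC a) key // addrC.
Qed.

Lemma padic_absD_max x y : abs (x + y) <= Num.max (abs x) (abs y).
Proof.
have ge0m : 0 <= Num.max (abs x) (abs y) by rewrite le_max padic_abs_ge0.
case: (eqVneq x 0) => [->|x0]; first by rewrite add0r le_max lexx orbT.
case: (eqVneq y 0) => [->|y0]; first by rewrite addr0 le_max lexx.
case: (eqVneq (x + y) 0) => [->|xy0]; first by rewrite padic_abs0.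
set d := denq x * denq y; set a := numq x * denq y; set b := numq y * denq x.
have d0 : d != 0 by rewrite mulf_neq0 ?denq_neq0.
have a0 : a != 0 by rewrite mulf_neq0 ?denq_neq0 ?numq_eq0.
have b0 : b != 0 by rewrite mulf_neq0 ?denq_neq0 ?numq_eq0.
have dx : (denq x)%:~R != 0 :> rat by rewrite intr_eq0 denq_neq0.
have dy : (denq y)%:~R != 0 :> rat by rewrite intr_eq0 denq_neq0.
have Ex : x = a%:~R / d%:~R.
  by rewrite /a /d !intrM -mulf_div divff // mulr1 divq_num_den.
have Ey : y = b%:~R / d%:~R.
  by rewrite /b /d !intrM [X in _ / X]mulrC -mulf_div divff // mulr1 divq_num_den.
have Exy : x + y = (a + b)%:~R / d%:~R by rewrite intrD mulrDl -Ex -Ey.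
have ab0 : a + b != 0.
  by apply: contraNneq xy0 => ab0; rewrite Exy ab0 mul0r.
rewrite Exy [in abs x]Ex [in abs y]Ey !abs_frac // le_max.
by case/orP: (wD a0 b0 ab0) => h; apply/orP; [left|right];
  rewrite ler_pM2l ?w_gt0 // lef_pV2 ?posrE ?w_gt0.
Qed.

Lemma padic_absD x y : abs (x + y) <= abs x + abs y.
Proof.
apply: le_trans (padic_absD_max x y) _; rewrite ge_max.
by rewrite lerDl lerDr !padic_abs_ge0.
Qed.

Lemma padic_absV x : abs x^-1 = (abs x)^-1.
Proof.
case: (eqVneq x 0) => [->|x0]; first by rewrite !(invr0, padic_abs0).
have ax0 : abs x != 0 by rewrite padic_abs_eq0.
by apply: (mulfI ax0); rewrite -padic_absM !divff // padic_abs1.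
Qed.

End PadicAbs.

Definition padic_cauchy (p : nat) (u : nat -> rat) : Prop :=
  forall e : rat, 0 < e -> exists N : nat, forall m n : nat,
    (N <= m)%N -> (N <= n)%N -> padic_abs p (u m - u n) < e.

Definition padic_null (p : nat) (u : nat -> rat) : Prop :=
  forall e : rat, 0 < e -> exists N : nat, forall n : nat,
    (N <= n)%N -> padic_abs p (u n) < e.

Section PadicCauchy.
Variable p : nat.
Local Notation abs := (padic_abs p).

Lemma padic_cauchy_bounded u : padic_cauchy p u ->
  exists2 M, 0 < M & forall n, abs (u n) <= M.
Proof.
move=> /(_ 1 ltr01)[N cN].
pose M := \sum_(i < N.+1) abs (u i) + 1.
have S0 n : 0 <= \sum_(i < n) abs (u i) by apply: sumr_ge0 => i _; exact: padic_abs_ge0.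
have le_S n : (n <= N)%N -> abs (u n) <= \sum_(i < N.+1) abs (u i).
  move=> nN; have nN' : (n < N.+1)%N by [].
  rewrite (bigD1 (Ordinal nN')) //= lerDl sumr_ge0 // => i _.
  exact: padic_abs_ge0.
exists M => [|n]; first by rewrite ltr_wpDl.
case: (leqP n N) => [nN|/ltnW Nn].
  by rewrite (le_trans (le_S _ nN)) // lerDl ler01.
rewrite -(subrK (u N) (u n)) (le_trans (padic_absD _ _ _)) // addrC lerD //.
  exact: le_S.
by rewrite ltW // cN.
Qed.

Definition cauchy_pred : {pred nat -> rat} := fun u => `[< padic_cauchy p u >].

Lemma cauchy_predP u : reflect (padic_cauchy p u) (u \in cauchy_pred).
Proof. exact: asboolP. Qed.

Lemma cauchy_pred_subring : subring_closed cauchy_pred.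
Proof.
split=> [|u v /cauchy_predP cu /cauchy_predP cv|u v /cauchy_predP cu /cauchy_predP cv];
  apply/cauchy_predP => e e0.
- by exists 0%N => m n _ _; rewrite subrr padic_abs0.
- have e20 : 0 < e / 2 by rewrite divr_gt0.
  have [N1 h1] := cu _ e20; have [N2 h2] := cv _ e20.
  exists (maxn N1 N2) => m n; rewrite !geq_max => /andP[m1 m2] /andP[n1 n2].
  have -> : (u - v) m - (u - v) n = (u m - u n) + - (v m - v n).
    by rewrite -[(u - v) m]/(u m - v m) -[(u - v) n]/(u n - v n) !opprD addrACA.
  rewrite (le_lt_trans (padic_absD _ _ _)) // padic_absN [ltRHS](splitr e).
  by rewrite ltrD ?h1 ?h2.
- have [A A0 hA] := padic_cauchy_bounded cu.
  have [B B0 hB] := padic_cauchy_bounded cv.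
  have eA : 0 < e / 2 / A by rewrite !divr_gt0.
  have eB : 0 < e / 2 / B by rewrite !divr_gt0.
  have [N1 h1] := cu _ eB; have [N2 h2] := cv _ eA.
  exists (maxn N1 N2) => m n; rewrite !geq_max => /andP[m1 m2] /andP[n1 n2].
  have -> : (u * v) m - (u * v) n = (u m - u n) * v m + u n * (v m - v n).
    rewrite -[(u * v) m]/(u m * v m) -[(u * v) n]/(u n * v n).
    by rewrite mulrBl mulrBr addrA subrK.
  rewrite (le_lt_trans (padic_absD _ _ _)) // !padic_absM [ltRHS](splitr e).
  rewrite ltrD //.
    apply: le_lt_trans (_ : _ <= abs (u m - u n) * B) _.
      by rewrite ler_wpM2l ?padic_abs_ge0.
    by rewrite -ltr_pdivlMr // h1.
  apply: le_lt_trans (_ : _ <= A * abs (v m - v n)) _.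
    by rewrite ler_wpM2r ?padic_abs_ge0.
  by rewrite mulrC -ltr_pdivlMr // h2.
Qed.

HB.instance Definition _ :=
  GRing.isSubringClosed.Build (nat -> rat) cauchy_pred cauchy_pred_subring.

Record cauchy_seq := CauchySeq { cauchy_val : nat -> rat; _ : cauchy_val \in cauchy_pred }.

HB.instance Definition _ := [isSub for cauchy_val].
HB.instance Definition _ := [Choice of cauchy_seq by <:].
HB.instance Definition _ := [SubChoice_isSubComNzRing of cauchy_seq by <:].

Lemma cauchy_seqP (u : cauchy_seq) : padic_cauchy p (val u).
Proof. by apply/cauchy_predP; exact: valP. Qed.

Definition null_pred : {pred cauchy_seq} := fun u => `[< padic_null p (val u) >].

Lemma null_predP u : reflect (padic_null p (val u)) (u \in null_pred).
Proof. exact: asboolP. Qed.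

Lemma null_pred_ideal : idealr_closed null_pred.
Proof.
split=> [||a u v /null_predP nu /null_predP nv].
- by apply/null_predP => e e0; exists 0%N => n _; rewrite padic_abs0.
- apply/null_predP => /(_ 1 ltr01)[N /(_ N (leqnn N))].
  by rewrite padic_abs1 ltxx.
- apply/null_predP => e e0.
  have [A A0 hA] := padic_cauchy_bounded (cauchy_seqP a).
  have e20 : 0 < e / 2 by rewrite divr_gt0.
  have eA : 0 < e / 2 / A by rewrite !divr_gt0.
  have [N1 h1] := nu _ eA; have [N2 h2] := nv _ e20.
  exists (maxn N1 N2) => n; rewrite !geq_max => /andP[n1 n2].
  have -> : val (a * u + v) n = val a n * val u n + val v n by [].
  rewrite (le_lt_trans (padic_absD _ _ _)) // padic_absM [ltRHS](splitr e).
  rewrite ltrD ?h2 //; apply: le_lt_trans (_ : _ <= A * abs (val u n)) _.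
    by rewrite ler_wpM2r ?padic_abs_ge0.
  by rewrite mulrC -ltr_pdivlMr // h1.
Qed.

HB.instance Definition _ := isIdealr.Build cauchy_seq null_pred null_pred_ideal.

(* Q_p as the completion of Q for |.|_p: Cauchy sequences modulo null ones. *)
Definition Qp := {ideal_quot null_pred}.

HB.instance Definition _ := GRing.ComNzRing.on Qp.
End PadicCauchy.

Section PadicField.
Variable p : nat.
Local Notation abs := (padic_abs p).
Local Open Scope quotient_scope.

Lemma padic_cauchy_const (u : nat -> rat) : padic_cauchy p u -> ~ padic_null p u ->
  exists2 c, 0 < c & exists N, forall n, (N <= n)%N -> abs (u n) = c.
Proof.
move=> cu /existsNP[e /not_implyP[e0 /forallNP nu]].
have [N cN] := cu _ e0.
have /existsNP[k /not_implyP[Nk /negP]] := nu N.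
rewrite -leNgt => ek; exists (abs (u k)); first exact: lt_le_trans e0 ek.
exists N => n Nn; apply/eqP; rewrite eq_le; apply/andP; split.
  rewrite -[u n](subrK (u k)) (le_trans (padic_absD_max _ _ _)) // ge_max lexx.
  by rewrite andbT (le_trans _ ek) // ltW // cN.
have := padic_absD_max p (u k - u n) (u n); rewrite subrK le_max.
by rewrite leNgt (lt_le_trans (cN _ _ Nk Nn) ek).
Qed.

Lemma padic_cauchyV (u : nat -> rat) : padic_cauchy p u -> ~ padic_null p u ->
  padic_cauchy p (fun n => (u n)^-1).
Proof.
move=> cu nu e e0; have [c c0 [N1 cN]] := padic_cauchy_const cu nu.
have ec : 0 < e * (c * c) by rewrite !mulr_gt0.
have [N2 h2] := cu _ ec.
exists (maxn N1 N2) => m n; rewrite !geq_max => /andP[m1 m2] /andP[n1 n2].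
have u0 k : (N1 <= k)%N -> u k != 0.
  by move=> k1; rewrite -(padic_abs_eq0 p) cN // gt_eqF.
have -> : (u m)^-1 - (u n)^-1 = (u n - u m) / (u m * u n).
  by field; rewrite !u0.
by rewrite padic_absM padic_absV padic_absM !cN // ltr_pdivrMr ?mulr_gt0 // h2.
Qed.

Definition Qp_inv (x : Qp p) : Qp p :=
  if x == 0 then 0
  else \pi_(Qp p) (insubd 0 (fun n => (val (repr x) n)^-1)).

Lemma Qp_eq0 (u : cauchy_seq p) :
  reflect (padic_null p (val u)) (\pi_(Qp p) u == 0).
Proof.
have -> : (\pi_(Qp p) u == 0) = (u \in null_pred (p := p)).
  by rewrite -[0](rmorph0 (\pi_(Qp p))) -Quotient.idealrBE subr0.
exact: null_predP.
Qed.

Lemma Qp_mulVf (x : Qp p) : x != 0 -> Qp_inv x * x = 1.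
Proof.
move=> x0; rewrite /Qp_inv (negbTE x0); set u := repr x.
have nu : ~ padic_null p (val u) by move=> /Qp_eq0; rewrite reprK (negbTE x0).
have cu := cauchy_seqP u.
have cV : (fun n => (val u n)^-1) \in cauchy_pred p.
  by apply/cauchy_predP; exact: padic_cauchyV.
rewrite -[x in _ * x]reprK -/u -rmorphM; apply/eqP; rewrite -subr_eq0.
rewrite -(rmorph1 (\pi_(Qp p))) -rmorphB; apply/Qp_eq0 => e e0.
have [c c0 [N cN]] := padic_cauchy_const cu nu; exists N => n Nn.
have -> : val (insubd 0 (fun n => (val u n)^-1) * u - 1) n
    = val (insubd (0 : cauchy_seq p) (fun n => (val u n)^-1)) n * val u n - 1.
  by [].
by rewrite insubdK // mulVf ?subrr ?padic_abs0 // -(padic_abs_eq0 p) cN // gt_eqF.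
Qed.

Lemma Qp_inv0 : Qp_inv 0 = 0. Proof. by rewrite /Qp_inv eqxx. Qed.

HB.instance Definition _ := GRing.ComNzRing_isField.Build (Qp p) Qp_mulVf Qp_inv0.

Definition padic_lim (u : nat -> rat) (r : rat) : Prop :=
  forall e : rat, 0 < e -> exists N : nat, forall n : nat,
    (N <= n)%N -> `|abs (u n) - r| < e.

(* |x|_p is the limit of |u_n|_p for any Cauchy sequence u representing x
   ([padic_norm_pi]). It is rational-valued, so the metric on [Qp p] is too. *)
Definition padic_norm (x : Qp p) : rat := xget 0 (padic_lim (val (repr x))).

Lemma padic_lim_ex (u : cauchy_seq p) : exists r, padic_lim (val u) r.
Proof.
case: (pselect (padic_null p (val u))) => [nu|nu].
  exists 0 => e /nu[N h]; exists N => n Nn.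
  by rewrite subr0 ger0_norm ?padic_abs_ge0 // h.
have [c c0 [N cN]] := padic_cauchy_const (cauchy_seqP u) nu.
by exists c => e e0; exists N => n Nn; rewrite cN // subrr normr0.
Qed.

Lemma padic_lim_unique u r s : padic_lim u r -> padic_lim u s -> r = s.
Proof.
move=> ur us; apply/eqP; rewrite -subr_eq0 -normr_le0; apply/ler_addgt0Pr => e e0; rewrite add0r.
have e20 : 0 < e / 2 by rewrite divr_gt0.
have [N1 h1] := ur _ e20; have [N2 h2] := us _ e20.
set n := maxn N1 N2; have := h1 n (leq_maxl _ _); have := h2 n (leq_maxr _ _).
move=> h h'; rewrite [leRHS](splitr e) (le_trans (ler_distD (abs (u n)) _ _)) //.
by rewrite lerD // ltW // distrC.
Qed.

Lemma padic_abs_dist x y : `|abs x - abs y| <= abs (x - y).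
Proof.
have h : forall a b, abs a <= abs (a - b) + abs b.
  by move=> a b; rewrite -{1}[a](subrK b) padic_absD.
have h1 := h x y; have := h y x; rewrite -(opprB x) padic_absN => h2.
by rewrite ler_norml; apply/andP; split; lra.
Qed.

Lemma padic_norm_pi (u : cauchy_seq p) r :
  padic_lim (val u) r -> padic_norm (\pi_(Qp p) u) = r.
Proof.
move=> ur; rewrite /padic_norm.
have nuv : padic_null p (val (repr (\pi_(Qp p) u) - u)).
  by apply/Qp_eq0; rewrite rmorphB /= reprK subrr.
have [s us] := padic_lim_ex (repr (\pi_(Qp p) u)).
case: xgetP => [s' -> {s us}us|/(_ s)//].
apply: (@padic_lim_unique (val u)) => // e e0.
have e20 : 0 < e / 2 by rewrite divr_gt0.
have [N1 h1] := us _ e20; have [N2 h2] := nuv _ e20.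
exists (maxn N1 N2) => n; rewrite geq_max => /andP[n1 n2].
rewrite (le_lt_trans (ler_distD (abs (val (repr (\pi_(Qp p) u)) n)) _ _)) //.
rewrite [ltRHS](splitr e) ltrD ?h1 // distrC.
by rewrite (le_lt_trans (padic_abs_dist _ _)) // h2.
Qed.

Lemma padic_normP (x : Qp p) : exists u : cauchy_seq p,
  x = \pi_(Qp p) u /\ padic_lim (val u) (padic_norm x).
Proof.
exists (repr x); rewrite reprK; split => //.
have [r ur] := padic_lim_ex (repr x).
by rewrite -{2}[x]reprK (padic_norm_pi ur).
Qed.

Lemma padic_norm0 : padic_norm 0 = 0.
Proof.
rewrite -(rmorph0 (\pi_(Qp p))); apply: padic_norm_pi => e e0.
by exists 0%N => n _; rewrite padic_abs0 subrr normr0.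
Qed.

Lemma padic_norm_eq0 x : padic_norm x = 0 -> x = 0.
Proof.
have [u [-> ]] := padic_normP x => /[swap] -> ul.
apply/eqP/Qp_eq0 => e /ul[N h]; exists N => n /h.
by rewrite subr0 ger0_norm ?padic_abs_ge0.
Qed.

Lemma padic_normN x : padic_norm (- x) = padic_norm x.
Proof.
have [u [-> ul]] := padic_normP x; rewrite -rmorphN; apply: padic_norm_pi.
move=> e /ul[N h]; exists N => n /h.
by rewrite -[val (- u) n]/(- val u n) padic_absN.
Qed.

Lemma padic_normD_max x y :
  padic_norm (x + y) <= Num.max (padic_norm x) (padic_norm y).
Proof.
have [u [xE ul]] := padic_normP x; have [v [yE vl]] := padic_normP y.
have [t tl] := padic_lim_ex (u + v).
rewrite (_ : padic_norm (x + y) = t); last first.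
  by rewrite xE yE -rmorphD (padic_norm_pi tl).
set m := Num.max _ _; rewrite leNgt; apply/negP => mt.
have e0 : 0 < (t - m) / 2 by rewrite divr_gt0 // subr_gt0.
have [N1 h1] := ul _ e0; have [N2 h2] := vl _ e0; have [N3 h3] := tl _ e0.
set n := maxn N1 (maxn N2 N3).
have {}h1 := h1 n (leq_maxl _ _).
have {}h2 := h2 n (leq_trans (leq_maxl _ _) (leq_maxr _ _)).
have {}h3 := h3 n (leq_trans (leq_maxr _ _) (leq_maxr _ _)).
have := padic_absD_max p (val u n) (val v n).
have xm : padic_norm x <= m by rewrite le_max lexx.
have ym : padic_norm y <= m by rewrite le_max lexx orbT.
move: h1 h2 h3; rewrite -[val (u + v) n]/(val u n + val v n) !ltr_distl.
move=> /andP[_ h1] /andP[_ h2] /andP[h3 _]; apply/negP; rewrite -ltNge gt_max.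
by apply/andP; split; lra.
Qed.

Lemma padic_norm_ge0 x : 0 <= padic_norm x.
Proof.
have := padic_normD_max x (- x).
by rewrite subrr padic_norm0 padic_normN maxxx.
Qed.

Let dist (x y : Qp p) : rat := padic_norm (x - y).

Let dist_xx x : dist x x = 0. Proof. by rewrite /dist subrr padic_norm0. Qed.

Let dist_eq0 x y : dist x y = 0 -> x = y.
Proof. by move=> /padic_norm_eq0 /subr0_eq. Qed.

Let dist_sym x y : dist x y = dist y x.
Proof. by rewrite /dist -padic_normN opprB. Qed.

Let dist_triangle y x z : dist x z <= dist x y + dist y z.
Proof.
have := padic_normD_max (x - y) (y - z); rewrite addrA subrK.
move=> /le_trans; apply; rewrite ge_max lerDl lerDr !padic_norm_ge0 //.
Qed.

HB.instance Definition _ :=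
  isMetric.Build rat (Qp p) dist_xx dist_eq0 dist_sym dist_triangle.

End PadicField.

Section GL2.
Variable p : nat.

Record GL2 := GL2_of { GL2_val :> 'M[Qp p]_2; GL2_unit : GL2_val \in unitmx }.

HB.instance Definition _ := [isSub for GL2_val].
HB.instance Definition _ := [Choice of GL2 by <:].

Definition GL2_one : GL2 := GL2_of (unitmx1 (Qp p) 2).

Lemma GL2_mul_subproof (g h : GL2) : (g : 'M_2) *m h \in unitmx.
Proof. by rewrite unitmx_mul !GL2_unit. Qed.

Definition GL2_mul (g h : GL2) : GL2 := GL2_of (GL2_mul_subproof g h).

Lemma GL2_inv_subproof (g : GL2) : invmx (g : 'M_2) \in unitmx.
Proof. by rewrite unitmx_inv GL2_unit. Qed.

Definition GL2_inv (g : GL2) : GL2 := GL2_of (GL2_inv_subproof g).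

Let GL2_mulA : associative GL2_mul.
Proof. by move=> f g h; apply: val_inj; exact: mulmxA. Qed.
Let GL2_mul1 : left_id GL2_one GL2_mul.
Proof. by move=> g; apply: val_inj; exact: mul1mx. Qed.
Let GL2_mulr1 : right_id GL2_one GL2_mul.
Proof. by move=> g; apply: val_inj; exact: mulmx1. Qed.
Let GL2_mulV : left_inverse GL2_one GL2_inv GL2_mul.
Proof. by move=> g; apply: val_inj; exact: mulVmx (GL2_unit g). Qed.
Let GL2_mulVr : right_inverse GL2_one GL2_inv GL2_mul.
Proof. by move=> g; apply: val_inj; exact: mulmxV (GL2_unit g). Qed.

HB.instance Definition _ := isGroup.Build GL2
  GL2_mulA GL2_mul1 GL2_mulr1 GL2_mulV GL2_mulVr.

(* The subspace topology of M_2(Q_p) is the usual one on GL_2(Q_p), because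
   inversion is continuous for it. *)
HB.instance Definition _ := Topological.copy GL2 (initial_topology GL2_val).

End GL2.

Definition Fpbar (p : nat) : closedFieldType :=
  tag (countable_algebraic_closure 'F_p).

Record rep (k : fieldType) (G : groupType) := Rep {
  rep_sort :> lmodType k;
  act : G -> {linear rep_sort -> rep_sort};
  act1 : forall v, act 1%g v = v;
  actM : forall g h v, act (g * h)%g v = act g (act h v)
}.
Arguments act {k G r} g.

Definition triv_rep (k : fieldType) (G : groupType) : rep k G :=
  @Rep k G k^o (fun _ => idfun) (fun _ => erefl) (fun _ _ _ => erefl).

(* Hom_G(V, W), as a set of functions from V to W. *)
Definition HomG (k : fieldType) (G : groupType) (V W : rep k G) : set (V -> W) :=
  [set f | linear f /\ forall g v, f (act g v) = act g (f v)].
Arguments HomG {k G} V W.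

(* Boolean predicates range over all subsets here, the logic being classical. *)
Definition irreducible (k : fieldType) (G : groupType) (V : rep k G) : Prop :=
  (exists v : V, v != 0) /\
  forall S : {pred V}, submod_closed S ->
    (forall g, {in S, forall v, act g v \in S}) ->
    S =i pred1 0 \/ S =i predT.

(* The linear subspace A of V is spanned by finitely many of its elements. *)
Definition finite_dim (k : fieldType) (V : lmodType k) (A : set V) : Prop :=
  exists s : seq V, (forall v, v \in s -> A v) /\
    A `<=` [set v | exists c : nat -> k, v = \sum_(i < size s) c i *: s`_i].

Definition invariants (k : fieldType) (G : groupType) (V : rep k G) (K : set G) : set V :=
  [set v | forall g, K g -> act g v = v].
Arguments invariants {k G} V K.

Definition smooth (p : nat) (V : rep (Fpbar p) (GL2 p)) : Prop :=
  forall v : V, open [set g | act g v = v].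

Definition admissible (p : nat) (V : rep (Fpbar p) (GL2 p)) : Prop :=
  smooth V /\
  forall K : set (GL2 p), group_closed (mem K) -> open K -> compact K ->
    finite_dim (invariants V K).

Section Tensor.
Variables (k : fieldType) (I : finType) (V : I -> lmodType k).

Definition multilinear (W : lmodType k) (f : (forall i, V i) -> W) : Prop :=
  forall (v : forall i, V i) (i : I) (a : k) (x y : V i),
    f (dfwith v i (a *: x + y)) = a *: f (dfwith v i x) + f (dfwith v i y).

Local Notation free := {freeg (forall i, V i) / k}.
Local Notation pure v := ([freeg [:: (1, v)]] : free).

(* The tensor product of the V i is the free vector space on their product,
   modulo the subspace [tensor_ker] generated by the multilinearity relations.
   Its universal property is [tens_multilinear], [tensor_lift_tens] and
   [tensor_ext]. *)
Definition tensor_rel : set free :=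
  [set z | exists (v : forall i, V i) (i : I) (a : k) (x y : V i),
     z = pure (dfwith v i (a *: x + y)) - (a *: pure (dfwith v i x) + pure (dfwith v i y))].

Definition tensor_ker : {pred free} := fun z =>
  `[< forall S : {pred free}, submod_closed S ->
        (forall r, tensor_rel r -> r \in S) -> z \in S >].

Lemma tensor_kerP z : reflect
  (forall S : {pred free}, submod_closed S ->
        (forall r, tensor_rel r -> r \in S) -> z \in S)
  (z \in tensor_ker).
Proof. exact: asboolP. Qed.

Lemma tensor_ker_submod : submod_closed tensor_ker.
Proof.
split=> [|a u v /tensor_kerP Ku /tensor_kerP Kv]; apply/tensor_kerP => S S_sub rS.
  by case: S_sub.
by case: (S_sub) => _; apply; [apply: Ku | apply: Kv].
Qed.

Lemma tensor_ker_zmod : zmod_closed tensor_ker.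
Proof. exact: GRing.submod_closedB tensor_ker_submod. Qed.

HB.instance Definition _ := GRing.isZmodClosed.Build free tensor_ker tensor_ker_zmod.

Definition tensor := Quotient.quot tensor_ker.

HB.instance Definition _ := GRing.Zmodule.on tensor.
HB.instance Definition _ := EqQuotient.on tensor.

Local Open Scope quotient_scope.

Definition tensor_scale (a : k) (t : tensor) : tensor :=
  \pi_tensor (a *: repr t).

Lemma tensor_pi_eq (x y : free) :
  x - y \in tensor_ker -> \pi_tensor x = \pi_tensor y.
Proof. by rewrite Quotient.idealrBE => /eqP. Qed.

Lemma pi_tensor_scale a x :
  tensor_scale a (\pi_tensor x) = \pi_tensor (a *: x).
Proof.
apply: tensor_pi_eq; rewrite -scalerBr.
have [K0 KL] := tensor_ker_submod.
rewrite -[_ *: _]addr0; apply: KL => //.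
by rewrite Quotient.idealrBE reprK.
Qed.

Lemma pi_tensorD x y : \pi_tensor (x + y) = \pi_tensor x + \pi_tensor y.
Proof. exact: Quotient.pi_add. Qed.

Lemma tensor_piP (t : tensor) : exists x, t = \pi_tensor x.
Proof. by exists (repr t); rewrite reprK. Qed.

Let scaleA a b t : tensor_scale a (tensor_scale b t) = tensor_scale (a * b) t.
Proof. by have [x ->] := tensor_piP t; rewrite 3!pi_tensor_scale scalerA. Qed.
Let scale1 : left_id 1 tensor_scale.
Proof. by move=> t; have [x ->] := tensor_piP t; rewrite pi_tensor_scale scale1r. Qed.
Let scaleDr : right_distributive tensor_scale +%R.
Proof.
move=> a s t; have [x ->] := tensor_piP s; have [y ->] := tensor_piP t.
by rewrite -pi_tensorD 3!pi_tensor_scale scalerDr pi_tensorD.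
Qed.
Let scaleDl t : {morph tensor_scale^~ t : a b / a + b}.
Proof.
by move=> a b; have [x ->] := tensor_piP t; rewrite 3!pi_tensor_scale scalerDl pi_tensorD.
Qed.

HB.instance Definition _ :=
  GRing.Zmodule_isLmodule.Build k tensor scaleA scale1 scaleDr scaleDl.

Definition tens (v : forall i, V i) : tensor := \pi_tensor (pure v).

Lemma tens_multilinear : multilinear tens.
Proof.
move=> v i a x y; rewrite /tens.
have -> : a *: (\pi_tensor (pure (dfwith v i x)) : tensor)
    = \pi_tensor (a *: pure (dfwith v i x)) by exact: pi_tensor_scale.
rewrite -pi_tensorD; apply: tensor_pi_eq; apply/tensor_kerP => S _; apply.
by exists v, i, a, x, y.
Qed.

Section Lift.
Variables (W : lmodType k) (f : (forall i, V i) -> W).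
Hypothesis f_ml : multilinear f.

Let F : free -> W := fglift f.

Let F_linear a x y : F (a *: x + y) = a *: F x + F y.
Proof.
have FB := lift_is_additive f : forall x y, F (x - y) = F x - F y.
have F0 : F 0 = 0 by rewrite -(subrr 0) FB subrr.
have FD u v : F (u + v) = F u + F v.
  by rewrite -{1}[v]opprK FB -[- v]sub0r FB F0 sub0r opprK.
rewrite FD; congr (_ + _); rewrite -[in RHS](freeg_sumE x).
rewrite [a *: x]/(fgscale a x) /fgscale !(big_morph F FD F0) scaler_sumr.
by apply: eq_bigr => z _; rewrite /F !liftU scalerA.
Qed.

Let F_ker z : z \in tensor_ker -> F z = 0.
Proof.
have F0 : F 0 = 0 by have := F_linear (-1) 0 0; rewrite !scaleN1r oppr0 addr0 addNr.
have FN x : F (- x) = - F x.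
  by have := F_linear (-1) x 0; rewrite !scaleN1r !addr0 F0 addr0.
have FD x y : F (x + y) = F x + F y by have := F_linear 1 x y; rewrite !scale1r.
pose S : {pred free} := fun z => F z == 0.
move=> /tensor_kerP /(_ S) Kz; apply/eqP; apply: Kz.
  split=> [|a x y]; rewrite !unfold_in /S ?F0 // => /eqP x0 /eqP y0.
  by rewrite F_linear x0 y0 scaler0 addr0.
move=> _ [v [i [a [x [y ->]]]]]; rewrite unfold_in /S FD FN F_linear.
by rewrite /F !liftU !scale1r f_ml subrr.
Qed.

Definition tensor_lift_fun (t : tensor) : W := fglift f (repr t).

Let lift_pi z : tensor_lift_fun (\pi_tensor z) = F z.
Proof.
rewrite /tensor_lift_fun -/F; apply/eqP; rewrite -subr_eq0.
have := F_linear (-1) z (repr (\pi_tensor z)).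
rewrite !scaleN1r ![- _ + _]addrC => <-; apply/eqP/F_ker.
by rewrite Quotient.idealrBE reprK.
Qed.

Lemma tensor_lift_linear : linear tensor_lift_fun.
Proof.
move=> a s t; have [x ->] := tensor_piP s; have [y ->] := tensor_piP t.
have -> : a *: (\pi_tensor x : tensor) = \pi_tensor (a *: x).
  exact: pi_tensor_scale.
by rewrite -pi_tensorD !lift_pi F_linear.
Qed.

HB.instance Definition _ :=
  GRing.isLinear.Build k tensor W *:%R tensor_lift_fun tensor_lift_linear.

Definition tensor_lift : {linear tensor -> W} := tensor_lift_fun.

Lemma tensor_lift_tens v : tensor_lift (tens v) = f v.
Proof. by rewrite /tensor_lift /= lift_pi /F liftU scale1r. Qed.

End Lift.

Lemma tensor_span (t : tensor) : exists s : seq (k * (forall i, V i)),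
  t = \sum_(z <- s) z.1 *: tens z.2.
Proof.
have [x ->] := tensor_piP t; exists [seq (coeff v x, v) | v <- dom x].
have pi0 : \pi_tensor (0 : free) = 0.
  by apply: (addrI (\pi_tensor (0 : free))); rewrite -pi_tensorD !addr0.
rewrite big_map /= -[in LHS](freeg_sumE x) (big_morph _ pi_tensorD pi0).
apply: eq_bigr => v _; rewrite [RHS]pi_tensor_scale; congr (\pi_tensor _).
by apply/eqP/freeg_eqP => w; rewrite coeffZ !coeffU mul1r.
Qed.

Lemma tensor_ext (W : lmodType k) (f g : {linear tensor -> W}) :
  (forall v, f (tens v) = g (tens v)) -> f =1 g.
Proof.
move=> fg t; have [s ->] := tensor_span t; rewrite !linear_sum.
by apply: eq_bigr => z _; rewrite !linearZ fg.
Qed.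

End Tensor.

Section TensorRep.
Variables (k : fieldType) (G : groupType) (I : finType) (V : I -> rep k G).

Let gtens (g : G) (v : forall i, V i) : tensor V := tens (fun i => act g (v i)).

Let gtens_ml g : multilinear (gtens g).
Proof.
move=> v i a x y; rewrite /gtens.
have E z : (fun j => act g (dfwith v i z j)) = dfwith (fun j => act g (v j)) i (act g z).
  apply: functional_extensionality_dep => j.
  by case: (dfwithP v z) => [|j' ij]; rewrite ?dfwithin ?dfwithout.
by rewrite !E linearP; exact: tens_multilinear.
Qed.

Definition tensor_act (g : G) : {linear tensor V -> tensor V} :=
  tensor_lift (@gtens_ml g).

Lemma tensor_act_tens g v : tensor_act g (tens v) = tens (fun i => act g (v i)).
Proof. exact: tensor_lift_tens. Qed.

Lemma tensor_act1 t : tensor_act 1%g t = t.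
Proof.
apply: (tensor_ext (g := idfun)) => v; rewrite tensor_act_tens /=; congr tens.
by apply: functional_extensionality_dep => i; rewrite act1.
Qed.

Lemma tensor_actM g h t : tensor_act (g * h)%g t = tensor_act g (tensor_act h t).
Proof.
apply: (tensor_ext (g := tensor_act g \o tensor_act h)) => v.
rewrite /= !tensor_act_tens; congr tens.
by apply: functional_extensionality_dep => i; rewrite actM.
Qed.

Definition tensor_rep : rep k G := Rep tensor_act1 tensor_actM.

End TensorRep.

(* Main.v *)
Require Import Defs.
From mathcomp Require Import all_boot all_order all_algebra closed_field.
From mathcomp Require Import generic_quotient ring_quotient.
From mathcomp Require Import all_classical topology.
From mathcomp Require Import ring.
Set Implicit Arguments.
Unset Strict Implicit.
Unset Printing Implicit Defensive.
Import Order.TTheory GRing.Theory Num.Theory.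
Local Open Scope classical_set_scope.
Local Open Scope ring_scope.

(** Write G for GL_2(Q_p), k for the algebraic closure of F_p and K_n for the
    congruence subgroup 1 + p^n M_2(Z_p) of G, where n > 0.

    Let f be a nonzero G-equivariant map from the tensor product to the trivial
    representation, and let v be a pure tensor on which it does not vanish.
    Replacing the first factor of v by a variable x gives a nonzero linear
    functional lam on the first representation V. By equivariance, and since
    the other factors of v have open stabilizers, lam is invariant under K_n for
    n large. So it suffices to prove that an admissible irreducible V with a
    nonzero smooth linear functional lam is finite-dimensional
    ([finite_dim_of_smooth_functional]).

    By irreducibility, the translates x |-> lam (g x) have no common zero but 0.
    The group H = K_1 is open and compact, so the space V^H of H-fixed vectors is
    finite-dimensional, and finitely many translates, by s_1, ..., s_m say, are
    enough to separate 0 from the other vectors of V^H ([finite_subfamily]).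
    Let X be the space of the x such that lam (s_i h x) = 0 for all i and all h
    in H. It is H-stable and contains no nonzero H-fixed vector. But H is a pro-p
    group and k has characteristic p, so a nonzero H-stable space of smooth
    vectors contains a nonzero fixed vector ([congr_fixed_vector]); hence X = 0.
    Now lam (s_i h x) depends only on i, x and the class of h modulo an open
    subgroup of H, because lam is smooth. There are finitely many such classes
    ([congr_transversal]), so finitely many linear functionals separate the
    points of V, and V is finite-dimensional ([finite_dim_separated]).

    The fixed vectors are found by going from K_(n+1) to K_n. The quotient
    K_n / K_(n+1) is abelian of exponent p, so it acts on the K_(n+1)-fixed vectors
    by commuting operators g with (g - 1)^p = g^p - 1 = 0, which have a common
    nonzero fixed vector ([congr_fixed_descent]).

    The compactness of K_1 comes from p-adic digits: modulo p^n there are finitely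
    many p-adic integers, so an ultrafilter on K_1 chooses a compatible sequence of
    digits, whose limit exists in Q_p ([congr_subgroup_compact]). *)

(** * The p-adic norm *)

Section PadicNorm.
Variable p : nat.
Local Open Scope quotient_scope.
Implicit Types (x y : Qp p) (u v : cauchy_seq p).

(** Rationals that are closer to each other than to 0 have the same p-adic absolute
    value, so along a Cauchy sequence which is not null it is eventually constant.
    This turns statements on limits into statements on a single late term. *)
Lemma padic_norm_eventually u : \pi_(Qp p) u != 0 ->
  exists N, forall k, (N <= k)%N -> padic_abs p (val u k) = padic_norm (\pi_(Qp p) u).
Proof.
move=> /Qp_eq0 nu; have [c c0 [N cN]] := padic_cauchy_const (cauchy_seqP u) nu.
exists N => k Nk; rewrite cN //; symmetry; apply: padic_norm_pi => e e0.
by exists N => m Nm; rewrite cN // subrr normr0.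
Qed.

Lemma padic_norm_le u r : 0 <= r ->
  (exists N, forall k, (N <= k)%N -> padic_abs p (val u k) <= r) ->
  padic_norm (\pi_(Qp p) u) <= r.
Proof.
move=> r0 [N h]; case: (eqVneq (\pi_(Qp p) u) 0) => [->|/padic_norm_eventually[M hM]].
  by rewrite padic_norm0.
by rewrite -(hM (maxn M N)) ?leq_maxl // h ?leq_maxr.
Qed.

Lemma padic_normM x y : padic_norm (x * y) = padic_norm x * padic_norm y.
Proof.
case: (eqVneq x 0) => [->|]; first by rewrite mul0r padic_norm0 mul0r.
case: (eqVneq y 0) => [->|]; first by rewrite mulr0 padic_norm0 mulr0.
rewrite -[x]reprK -[y]reprK; move: (repr x) (repr y) => u v v0 u0.
have [N hN] := padic_norm_eventually u0; have [M hM] := padic_norm_eventually v0.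
have uv0 : \pi_(Qp p) (u * v) != 0 by have := mulf_neq0 u0 v0; rewrite -rmorphM.
rewrite -rmorphM; have [K hK] := padic_norm_eventually uv0.
pose m := maxn K (maxn N M).
have hm : (N <= m)%N /\ (M <= m)%N by rewrite /m; split; rewrite !leq_max leqnn ?orbT.
rewrite -(hK m) ?leq_maxl // -(hN m) ?hm.1 // -(hM m) ?hm.2 //.
exact: padic_absM.
Qed.

Lemma cauchy_natE n k : val (n%:R : cauchy_seq p) k = n%:R.
Proof. by elim: n => [|n IH] //; rewrite [in RHS]mulrS [in LHS]mulrS -IH. Qed.

Lemma padic_norm_nat n : padic_norm (n%:R : Qp p) = padic_abs p n%:R.
Proof.
have -> : n%:R = \pi_(Qp p) (n%:R : cauchy_seq p) by rewrite rmorph_nat.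
by apply: padic_norm_pi => e e0; exists 0%N => k _; rewrite cauchy_natE subrr normr0.
Qed.

Lemma padic_norm1 : padic_norm (1 : Qp p) = 1.
Proof. by rewrite -[1]/(1%:R) padic_norm_nat padic_abs1. Qed.

Lemma padic_norm_distC x y : padic_norm (x - y) = padic_norm (y - x).
Proof. by rewrite -padic_normN opprB. Qed.

Lemma padic_abs_distC a b : padic_abs p (a - b) = padic_abs p (b - a).
Proof. by rewrite -padic_absN opprB. Qed.

Lemma padic_normD_le x y r : padic_norm x <= r -> padic_norm y <= r ->
  padic_norm (x + y) <= r.
Proof. by move=> xr yr; rewrite (le_trans (padic_normD_max _ _)) // ge_max xr. Qed.

Lemma padic_dist_le z x y r : padic_norm (x - z) <= r -> padic_norm (y - z) <= r ->
  padic_norm (x - y) <= r.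
Proof.
move=> xz yz; rewrite -(subrK z x) -addrA; apply: padic_normD_le xz _.
by rewrite padic_norm_distC.
Qed.

End PadicNorm.

(** * Digits of p-adic integers *)

Section PadicIntegers.
Variables (p : nat) (p_prime : prime p).

Let p_gt0 : 0 < p%:R :> rat. Proof. by rewrite ltr0n prime_gt0. Qed.
Let p_ge1 : 1 <= p%:R :> rat. Proof. by rewrite ler1n prime_gt0. Qed.

Lemma padic_abs_int_le1 (z : int) : padic_abs p z%:~R <= 1.
Proof.
rewrite /padic_abs; case: ifP => // _.
by rewrite denq_int logn1 expr0 mul1r invf_le1 ?exprn_gt0 // exprn_ege1.
Qed.

Lemma padic_abs_expp n : padic_abs p (p%:R ^+ n) = p%:R ^- n.
Proof.
rewrite -natrX /padic_abs pnatr_eq0 expn_eq0 (gtn_eqF (prime_gt0 p_prime)) /=.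
rewrite [(p ^ n)%:R]pmulrn denq_int numq_int absz_nat (pfactorK n p_prime).
by rewrite [logn p _]logn1 expr0 mul1r -pmulrn natrX.
Qed.

Lemma padic_norm_p : padic_norm (p%:R : Qp p) = p%:R ^-1.
Proof. by rewrite padic_norm_nat -[p%:R]expr1 padic_abs_expp. Qed.

Lemma padic_abs_le1_coprime (q : rat) : padic_abs p q <= 1 ->
  coprime p `|denq q|.
Proof.
rewrite prime_coprime //; case: (eqVneq q 0) => [->|q0].
  by move=> _; rewrite dvdn1 gtn_eqF // prime_gt1.
apply: contraTN => pd; rewrite -ltNge /padic_abs (negbTE q0).
have pn : ~~ (p %| `|numq q|)%N.
  apply/negP => pn; have := coprime_num_den q; rewrite /coprime => /eqP c1.
  have : (p %| 1)%N by rewrite -c1 dvdn_gcd pn pd.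
  by rewrite dvdn1 gtn_eqF // prime_gt1.
rewrite [logn p `|numq q|]lognE (negbTE pn) !andbF expr0 divr1.
by rewrite exprn_egt1 ?ltr1n ?prime_gt1 // -lt0n logn_gt0 mem_primes p_prime
  absz_gt0 denq_neq0.
Qed.

(** The denominator of q is prime to p, hence invertible modulo p^n; the digits
    are the residue of the numerator times that inverse. *)
Lemma padic_abs_digits (q : rat) n : padic_abs p q <= 1 ->
  exists2 a, (a < p ^ n)%N & padic_abs p (q - a%:R) <= p%:R ^- n.
Proof.
move=> /padic_abs_le1_coprime cop.
have [u [v]] := Bezoutz (denq q) (p ^ n)%N%:Z.
have -> : gcdz (denq q) (p ^ n)%N = 1.
  rewrite /gcdz absz_nat; congr (Posz _); apply/eqP.
  by rewrite -/(coprime _ _) coprime_sym coprimeXl.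
move=> bez.
have pn0 : (p ^ n)%N%:Z != 0 by rewrite eqz_nat expn_eq0 (gtn_eqF (prime_gt0 p_prime)).
set c := (numq q * u %% (p ^ n)%N%:Z)%Z.
have c0 : 0 <= c by rewrite modz_ge0.
exists `|c|%N.
  by rewrite -ltz_nat gez0_abs // ltz_pmod // ltz_nat expn_gt0 prime_gt0.
set k := (numq q * u %/ (p ^ n)%N%:Z)%Z.
have E : numq q - c * denq q = (p ^ n)%N%:Z * (numq q * v + k * denq q).
  have -> : c = numq q * u - k * (p ^ n)%N%:Z.
    by rewrite [numq q * u](divz_eq _ (p ^ n)%N%:Z) addrC addKr.
  by rewrite -{1}[numq q]mulr1 -bez; ring.
have d0 : (denq q)%:~R != 0 :> rat by rewrite intr_eq0 denq_neq0.
have -> : q - `|c|%N%:R = p%:R ^+ n * ((numq q * v + k * denq q)%:~R / (denq q)%:~R).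
  have -> : (`|c|%N%:R : rat) = c%:~R by rewrite -{2}(gez0_abs c0).
  rewrite -[q in LHS]divq_num_den mulrA -natrX [(p ^ n)%:R]pmulrn.
  by rewrite -intrM -E intrB intrM mulrBl mulfK.
rewrite padic_absM padic_abs_expp ler_piMr ?invr_ge0 ?exprn_ge0 ?(ltW p_gt0) //.
rewrite padic_absM padic_absV [X in _ / X](_ : _ = 1) ?divr1 ?padic_abs_int_le1 //.
rewrite /padic_abs (negbTE d0) denq_int numq_int logn1 expr0 div1r.
suff -> : logn p `|denq q| = 0%N by rewrite expr0 invr1.
by rewrite lognE; move: cop; rewrite prime_coprime // => /negbTE ->; rewrite !andbF.
Qed.
End PadicIntegers.

Section Digits.
Variables (p : nat) (p_prime : prime p).
Local Open Scope quotient_scope.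

Let p_gt0 : 0 < p%:R :> rat. Proof. by rewrite ltr0n prime_gt0. Qed.

Lemma exprVp_ge0 n : 0 <= p%:R ^- n :> rat.
Proof. by rewrite invr_ge0 exprn_ge0 // ltW. Qed.

Lemma exprVp_gt0 n : 0 < p%:R ^- n :> rat.
Proof. by rewrite invr_gt0 exprn_gt0. Qed.

Lemma le_exprVp m n : (m <= n)%N -> p%:R ^- n <= p%:R ^- m :> rat.
Proof.
move=> mn; rewrite lef_pV2 ?posrE ?exprn_gt0 // ler_weXn2l // ler1n prime_gt0 //.
Qed.

Lemma exprVp_lt (e : rat) : 0 < e -> exists n, p%:R ^- n < e.
Proof.
move=> e0; pose n := Num.Def.archi_bound e^-1; exists n.
rewrite -[ltRHS]invrK ltf_pV2 ?posrE ?exprn_gt0 ?invr_gt0 //.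
apply: (lt_trans (archi_boundP _)); first by rewrite invr_ge0 ltW.
by rewrite -natrX ltr_nat ltn_expl // prime_gt1.
Qed.

(** A late term of a Cauchy sequence of rationals is close to its limit, which
    reduces the claim to rational numbers. *)
Lemma padic_digits (x : Qp p) n : padic_norm x <= 1 ->
  exists a : 'I_(p ^ n), padic_norm (x - a%:R) <= p%:R ^- n.
Proof.
rewrite -[x]reprK; move: (repr x) => u {x} u1.
have [N1 hN1] := cauchy_seqP u (exprVp_gt0 n).
have [N2 hN2] : exists N, forall k, (N <= k)%N -> padic_abs p (val u k) <= 1.
  case: (pselect (padic_null p (val u))) => [nu|nu].
    by have [N h] := nu _ ltr01; exists N => k Nk; rewrite ltW // h.
  have [N h] := padic_norm_eventually (introN (@Qp_eq0 p u) nu).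
  by exists N => k /h ->.
pose N := maxn N1 N2.
have [a ltap ha] := padic_abs_digits p_prime n (hN2 N (leq_maxr _ _)).
exists (Ordinal ltap) => /=.
have -> : \pi_(Qp p) u - a%:R = \pi_(Qp p) (u - a%:R) by rewrite rmorphB rmorph_nat.
apply: padic_norm_le; first exact: exprVp_ge0.
exists N => k Nk.
rewrite -[val (u - _) k]/(val u k - val (a%:R : cauchy_seq p) k) cauchy_natE.
rewrite -(subrK (val u N) (val u k)) -addrA.
apply: le_trans (padic_absD_max _ _ _) _; rewrite ge_max ha andbT ltW // hN1 ?leq_maxl //.
exact: leq_trans (leq_maxl _ _) Nk.
Qed.

(** The Cauchy sequence consists of rational numbers, so its class is an element of
    Q_p, and that class is the limit. *)
Lemma padic_limit_exists (a : nat -> nat) :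
  (forall m n, (m <= n)%N -> padic_norm ((a m)%:R - (a n)%:R : Qp p) <= p%:R ^- m) ->
  exists x : Qp p, forall n, padic_norm (x - (a n)%:R) <= p%:R ^- n.
Proof.
move=> ca.
have absE m n : padic_abs p ((a m)%:R - (a n)%:R) = padic_norm ((a m)%:R - (a n)%:R : Qp p).
  case/orP: (leq_total (a n) (a m)) => nm; first by rewrite -!natrB // padic_norm_nat.
  by rewrite padic_abs_distC padic_norm_distC -!natrB // padic_norm_nat.
have cc : padic_cauchy p (fun n => (a n)%:R).
  move=> e /exprVp_lt[n ne]; exists n => k l nk nl.
  rewrite absE (le_lt_trans _ ne) // (@padic_dist_le _ (a n)%:R) //.
    by rewrite padic_norm_distC ca.
  by rewrite padic_norm_distC ca.
pose u : cauchy_seq p := CauchySeq (introT (cauchy_predP p _) cc).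
exists (\pi_(Qp p) u) => n.
have -> : \pi_(Qp p) u - (a n)%:R = \pi_(Qp p) (u - (a n)%:R) by rewrite rmorphB rmorph_nat.
apply: padic_norm_le; first exact: exprVp_ge0.
exists n => k nk.
rewrite -[val (u - _) k]/((a k)%:R - val ((a n)%:R : cauchy_seq p) k) cauchy_natE.
by rewrite absE padic_norm_distC ca.
Qed.

End Digits.

(** * Congruence subgroups of GL_2(Q_p) *)

Section Congruence.
Variables (p : nat) (p_prime : prime p).
Implicit Types (A B : 'M[Qp p]_2) (g h : GL2 p) (m n : nat).

Let p_gt0 : 0 < p%:R :> rat. Proof. by rewrite ltr0n prime_gt0. Qed.

(** Membership in p^n M_2(Z_p). *)
Definition small n A : Prop := forall i j, padic_norm (A i j) <= p%:R ^- n.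

Lemma small_le m n A : (m <= n)%N -> small n A -> small m A.
Proof. by move=> mn sA i j; rewrite (le_trans (sA i j)) ?le_exprVp. Qed.

Lemma small_zero n : small n 0.
Proof. by move=> i j; rewrite mxE padic_norm0 exprVp_ge0. Qed.

Lemma smallD n A B : small n A -> small n B -> small n (A + B).
Proof. by move=> sA sB i j; rewrite mxE padic_normD_le. Qed.

Lemma smallN n A : small n A -> small n (- A).
Proof. by move=> sA i j; rewrite mxE padic_normN. Qed.

Lemma smallB n A B : small n A -> small n B -> small n (A - B).
Proof. by move=> sA sB; apply: smallD => //; exact: smallN. Qed.

Lemma smallM m n A B : small m A -> small n B -> small (m + n) (A *m B).
Proof.
move=> sA sB i j; rewrite mxE.
elim/big_ind: _ => [|x y|k _]; first by rewrite padic_norm0 exprVp_ge0.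
  exact: padic_normD_le.
by rewrite padic_normM exprD invfM ler_pM ?padic_norm_ge0.
Qed.

Lemma small1 : small 0 (1%:M : 'M[Qp p]_2).
Proof.
move=> i j; rewrite mxE expr0 invr1.
by case: (i == j); rewrite ?padic_norm1 // padic_norm0 ler01.
Qed.

Lemma small_scale_p n A : small n A -> small n.+1 (p%:R *: A).
Proof.
by move=> sA i j; rewrite mxE padic_normM padic_norm_p // exprS invfM ler_pM2l ?invr_gt0.
Qed.

(** Left multiplication by 1 + A preserves the sup norm of v, since A v is strictly
    smaller than v. The bound r is 1 when inverses are estimated, and 0 when
    invertibility is proved. *)
Lemma small_perturbation_bound q A (v : 'M[Qp p]_(2, q)) (r : rat) : small 1 A -> 0 <= r ->
  (forall i j, padic_norm ((v + A *m v) i j) <= r) ->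
  forall i j, padic_norm (v i j) <= r.
Proof.
move=> sA r0 sv i0 j0.
have [[i j] _ /= max_ij] := @arg_maxP _ _ _ (i0, j0) xpredT
  (fun ij : 'I_2 * 'I_q => padic_norm (v ij.1 ij.2)) isT.
have {}max_ij i' j' : padic_norm (v i' j') <= padic_norm (v i j) := max_ij (i', j') isT.
apply: le_trans (max_ij i0 j0) _; rewrite leNgt; apply/negP => gtr.
set N := padic_norm (v i j) in gtr.
have sAv : padic_norm ((A *m v) i j) <= p%:R^-1 * N.
  rewrite mxE; elim/big_ind: _ => [|x y|k _].
  - by rewrite padic_norm0 mulr_ge0 ?invr_ge0 ?padic_norm_ge0 ?ler0n.
  - exact: padic_normD_le.
  - by rewrite padic_normM ler_pM ?padic_norm_ge0 ?sA.
(* The largest entry of v is a difference of one of norm at most r and one of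
   norm at most N / p, which rules out r < N. *)
have : padic_norm (v i j) <= Num.max r (p%:R^-1 * N).
  rewrite -[v i j](addrK ((A *m v) i j)).
  apply: le_trans (padic_normD_max _ _) _; rewrite padic_normN.
  rewrite ge_max; apply/andP; split; rewrite le_max; last by rewrite sAv orbT.
  by have := sv i j; rewrite mxE => ->.
rewrite -/N le_max leNgt gtr /= -{1}[N]mul1r ler_pM2r ?(le_lt_trans r0) //.
by rewrite leNgt invf_lt1 // ltr1n prime_gt1.
Qed.

Lemma small_inv g : small 1 ((g : 'M_2) - 1%:M) -> small 0 (GL2_inv g : 'M_2).
Proof.
move=> sg; rewrite /small expr0 invr1; apply: (small_perturbation_bound sg) => // i j.
rewrite mulmxBl mul1mx mulmxV ?GL2_unit // addrC subrK.
by have := small1 i j; rewrite expr0 invr1.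
Qed.

Lemma small_unit A : small 1 (A - 1%:M) -> A \in unitmx.
Proof.
move=> sA; rewrite unitmxE unitfE -det_tr; apply/det0P => -[v v0 vA].
case/negP: v0; apply/eqP/trmx_inj/matrixP => i j; rewrite trmx0 [RHS]mxE.
apply: padic_norm_eq0; apply/eqP; rewrite eq_le padic_norm_ge0 andbT.
apply: (small_perturbation_bound sA) => // {}i {}j.
by rewrite mulmxBl mul1mx addrC subrK -[A]trmxK -trmx_mul vA trmx0 mxE padic_norm0.
Qed.

Definition congr_subgroup n : set (GL2 p) := [set g | small n ((g : 'M_2) - 1%:M)].
Local Notation K := congr_subgroup.

Lemma congr_subgroup_le m n : (m <= n)%N -> K n `<=` K m.
Proof. by move=> mn g; exact: small_le. Qed.

Lemma GL2_val1 : ((1%g : GL2 p) : 'M_2) = 1%:M. Proof. by []. Qed.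

Lemma GL2_valM g h : ((g * h)%g : 'M_2) = (g : 'M_2) *m (h : 'M_2). Proof. by []. Qed.

Lemma congr_subgroup1 n : K n 1%g.
Proof. by rewrite /K /mkset GL2_val1 subrr; exact: small_zero. Qed.

Lemma congr_subgroup_small0 g : K 1 g -> small 0 (g : 'M_2).
Proof.
by move=> Kg; rewrite -[g : 'M_2](subrK 1%:M); apply: smallD small1; exact: small_le Kg.
Qed.

Lemma congr_subgroup_div n g h : (0 < n)%N -> K 1 g -> K 1 h ->
  small n ((g : 'M_2) - (h : 'M_2)) -> K n (g^-1 * h)%g.
Proof.
move=> n0 Kg Kh sgh; rewrite /K /mkset.
have -> : GL2_inv g *m h - 1%:M = GL2_inv g *m ((h : 'M_2) - (g : 'M_2)).
  by rewrite mulmxBr mulVmx ?GL2_unit.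
rewrite -[n]add0n; apply: smallM; first exact: small_inv.
by rewrite -opprB; exact: smallN.
Qed.

Lemma congr_subgroupM n g h : K n g -> K n h -> K n (g * h)%g.
Proof.
move=> Kg Kh; rewrite /K /mkset.
have -> : ((g * h)%g : 'M_2) - 1%:M = ((g : 'M_2) - 1%:M) *m ((h : 'M_2) - 1%:M)
    + (((g : 'M_2) - 1%:M) + ((h : 'M_2) - 1%:M)).
  rewrite GL2_valM mulmxBl mulmxBr !mul1mx mulmx1.
  by apply/matrixP => i j; rewrite !mxE; ring.
apply: smallD; last exact: smallD.
by apply: (@small_le _ (n + n)); [exact: leq_addr | exact: smallM].
Qed.

Lemma congr_subgroupV n g : (0 < n)%N -> K n g -> K n g^-1%g.
Proof.
move=> n0 Kg; rewrite -[g^-1%g]mulg1; apply: congr_subgroup_div => //.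
  exact: congr_subgroup_le Kg.
exact: congr_subgroup1.
Qed.

Lemma congr_subgroup_group n : (0 < n)%N -> group_closed (mem (K n)).
Proof.
move=> n0; split=> [|g h]; first by rewrite inE; exact: congr_subgroup1.
rewrite !inE => Kg Kh; apply: congr_subgroupM => //; exact: congr_subgroupV.
Qed.

(** The quotient K_n / K_(n+1) is abelian because g h - h g is also the difference of
    the two products of g - 1 and h - 1, which lie in p^(2n) M_2(Z_p). *)
Lemma congr_subgroup_comm n g h : (0 < n)%N -> K n g -> K n h ->
  exists2 c, K n.+1 c & (g * h)%g = (h * g * c)%g.
Proof.
move=> n0 Kg Kh; exists ((h * g)^-1 * (g * h))%g; last by rewrite mulVKg.
have K1 f : K n f -> K 1 f by exact: congr_subgroup_le.
apply: (congr_subgroup_div (ltn0Sn n) (congr_subgroupM (K1 _ Kh) (K1 _ Kg))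
  (congr_subgroupM (K1 _ Kg) (K1 _ Kh))).
have -> : ((h * g)%g : 'M_2) - ((g * h)%g : 'M_2)
  = ((h : 'M_2) - 1%:M) *m ((g : 'M_2) - 1%:M) - ((g : 'M_2) - 1%:M) *m ((h : 'M_2) - 1%:M).
  rewrite !GL2_valM !mulmxBl !mulmxBr !mul1mx !mulmx1.
  apply/matrixP => i j; rewrite !mxE; ring.
apply: (@small_le _ (n + n)); first by rewrite -addn1 leq_add2l.
exact: smallB (smallM Kh Kg) (smallM Kg Kh).
Qed.

Lemma congr_subgroup_normal n g c : (0 < n)%N -> K 1 g -> K n c -> K n (g^-1 * (c * g))%g.
Proof.
move=> n0 Kg Kc; have K1c : K 1 c := congr_subgroup_le n0 Kc.
apply: (congr_subgroup_div n0 Kg (congr_subgroupM K1c Kg)).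
have -> : (g : 'M_2) - ((c * g)%g : 'M_2) = (1%:M - (c : 'M_2)) *m g.
  by rewrite GL2_valM mulmxBl mul1mx.
rewrite -[n]addn0; apply: smallM (congr_subgroup_small0 Kg).
by rewrite -opprB; exact: smallN.
Qed.

(** The quotient K_n / K_(n+1) has exponent p: modulo p^(n+1), the map g |-> g - 1
    turns products into sums, so g^p - 1 is congruent to p (g - 1). *)
Lemma congr_subgroup_expp n g : (0 < n)%N -> K n g -> K n.+1 (g ^+ p)%g.
Proof.
move=> n0 Kg.
have pow k : K n (g ^+ k)%g /\
    small n.+1 (((g ^+ k)%g : 'M_2) - 1%:M - k%:R *: ((g : 'M_2) - 1%:M)).
  elim: k => [|k [IHK IH]].
    rewrite expg0; split; first exact: congr_subgroup1.
    by rewrite scale0r subr0 GL2_val1 subrr; exact: small_zero.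
  rewrite expgS; split; first exact: congr_subgroupM.
  have -> : ((g * g ^+ k)%g : 'M_2) - 1%:M - k.+1%:R *: ((g : 'M_2) - 1%:M)
     = ((g : 'M_2) - 1%:M) *m (((g ^+ k)%g : 'M_2) - 1%:M)
       + (((g ^+ k)%g : 'M_2) - 1%:M - k%:R *: ((g : 'M_2) - 1%:M)).
    rewrite GL2_valM mulmxBl mulmxBr !mul1mx !mulmx1.
    by rewrite -[in k.+1%:R]addn1 natrD scalerDl scale1r; apply/matrixP => i j; rewrite !mxE; ring.
  apply: smallD IH.
  by apply: (@small_le _ (n + n)); [rewrite -addn1 leq_add2l | exact: smallM].
have [_ sp] := pow p.
rewrite /K /mkset -[X in small _ X](subrK (p%:R *: ((g : 'M_2) - 1%:M))).
exact: smallD sp (small_scale_p Kg).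
Qed.

End Congruence.

(** * The topology of GL_2(Q_p) *)

Lemma choice2 (X Y Z : Type) (P : X -> Y -> Z -> Prop) :
  (forall x y, exists z, P x y z) -> exists f, forall x y, P x y (f x y).
Proof.
by move=> ex; exists (fun x y => projT1 (cid (ex x y))) => x y; exact: projT2 (cid (ex x y)).
Qed.

Section Topology.
Variables (p : nat) (p_prime : prime p).
Implicit Types (A B : 'M[Qp p]_2) (g h : GL2 p) (m n : nat).
Local Notation K := congr_subgroup.

Lemma integral_center n A : small 0 A ->
  exists t : 'M['I_(p ^ n)]_2, small n (A - \matrix_(i, j) (t i j)%:R).
Proof.
move=> sA; have ex i j : exists a : 'I_(p ^ n), padic_norm (A i j - a%:R) <= p%:R ^- n.
  by apply: padic_digits => //; have := sA i j; rewrite expr0 invr1.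
have [t ht] := choice2 ex.
by exists (\matrix_(i, j) t i j) => i j; rewrite !mxE.
Qed.

(** Otherwise the ultrafilter would contain the complements of all the members of
    the cover, hence the empty set. *)
Lemma ultra_finite_cover (T : Type) (I : finType) (F : set_system T)
    (A : set T) (P : I -> set T) : UltraFilter F -> F A ->
  (forall x, A x -> exists i, P i x) -> exists i, F (P i).
Proof.
move=> FU FA cov; apply: contrapT => /forallNP nF.
have FN i : F (~` P i) by have [/nF|] := in_ultra_setVsetC (P i) FU.
have [x [nP Ax]] := filter_ex (filterI (filter_forall _ FN) FA).
by have [i Pi] := cov x Ax; exact: nP i Pi.
Qed.

Lemma nbhs_QpP (x : Qp p) (U : set (Qp p)) :
  nbhs x U <-> exists n, [set y | padic_norm (y - x) <= p%:R ^- n] `<=` U.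
Proof.
split=> [/nbhs_ballP[e /= e0]|[n sU]].
  rewrite ballEmdist => eU; have [n ne] := exprVp_lt p_prime e0.
  exists n => y /= xy; apply: eU; rewrite /= -[mdist x y]/(padic_norm (x - y)).
  by rewrite padic_norm_distC (le_lt_trans xy).
apply/nbhs_ballP; exists (p%:R ^- n); first exact: exprVp_gt0.
rewrite ballEmdist => y /= xy; apply: sU => /=.
by rewrite padic_norm_distC; exact: ltW.
Qed.

Lemma nbhs_GL2P g (U : set (GL2 p)) :
  nbhs g U <-> exists n, [set h : GL2 p | small n ((h : 'M_2) - (g : 'M_2))] `<=` U.
Proof.
split=> [|[n sU]].
  move=> [_ [[V Vo <-] Vg sVU]].
  have : nbhs (GL2_val g) V by apply: open_nbhs_nbhs.
  move=> [P nP sPV].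
  have {}nP i j : exists n, [set y | padic_norm (y - (g : 'M_2) i j) <= p%:R ^- n] `<=` P i j.
    by apply/nbhs_QpP; exact: nP.
  have [N hN] := choice2 nP.
  exists (\max_i \max_j N i j) => h sh; apply: sVU; apply: sPV => i j; apply: hN => /=.
  have := sh i j; rewrite !mxE => /le_trans; apply; apply: le_exprVp => //.
  exact: leq_trans (leq_bigmax j) (leq_bigmax (F := fun i => \max_j N i j) i).
apply: filterS sU _.
have : nbhs (GL2_val g) [set B : 'M[Qp p]_2 | small n (B - (g : 'M_2))].
  exists (fun i j => [set y | padic_norm (y - (g : 'M_2) i j) <= p%:R ^- n]).
    by move=> i j; apply/nbhs_QpP; exists n.
  by move=> B hB i j; rewrite !mxE; exact: hB.
exact: (@initial_continuous _ _ (@GL2_val p)).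
Qed.

Lemma congr_subgroup_open n : (0 < n)%N -> open (K n : set (GL2 p)).
Proof.
move=> n0; rewrite openE => g Kg; apply/nbhs_GL2P; exists n => h /= sh.
rewrite /K /mkset -(subrK (g : 'M_2) (h : 'M_2)) -addrA; exact: smallD sh Kg.
Qed.

(** An ultrafilter F on K_1 contains, for each n, the set of the matrices with some
    given digits modulo p^n. Two such sets meet, so the digits are compatible and
    converge; F converges to the limit, which is again congruent to 1 modulo p. *)
Lemma congr_subgroup_compact : compact (K 1 : set (GL2 p)).
Proof.
rewrite compact_ultra => F FU FK.
have ex n : exists t : 'M['I_(p ^ n)]_2,
    F [set g : GL2 p | small n ((g : 'M_2) - \matrix_(i, j) (t i j)%:R)].
  apply: (ultra_finite_cover FU FK) => g Kg.
  exact: integral_center (congr_subgroup_small0 p_prime Kg).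
pose t n := projT1 (cid (ex n)).
have Ft n : F [set g : GL2 p | small n ((g : 'M_2) - \matrix_(i, j) (t n i j)%:R)].
  exact: projT2 (cid (ex n)).
have ct i j m n : (m <= n)%N ->
    padic_norm ((t m i j)%:R - (t n i j)%:R : Qp p) <= p%:R ^- m.
  move=> mn; have [g /= [gm gn]] := filter_ex (filterI (Ft m) (Ft n)).
  have {gn}gn := small_le p_prime mn gn; move: (gm i j) (gn i j); rewrite !mxE => {}gm {}gn.
  by rewrite (padic_dist_le (z := (g : 'M_2) i j)) // padic_norm_distC.
have [L hL] : exists L : 'I_2 -> 'I_2 -> Qp p, forall i j n,
    padic_norm (L i j - (t n i j)%:R) <= p%:R ^- n.
  apply: (@choice2 _ _ _ (fun i j x => forall n, padic_norm (x - (t n i j)%:R) <= p%:R ^- n)).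
  by move=> i j; exact: padic_limit_exists (ct i j).
pose M : 'M[Qp p]_2 := \matrix_(i, j) L i j.
have FM n : F [set g : GL2 p | small n ((g : 'M_2) - M)].
  apply: filterS (Ft n) => g sg i j; have := sg i j; rewrite !mxE => {}sg.
  exact: padic_dist_le sg (hL i j n).
have M1 : small 1 (M - 1%:M).
  have [g [/= Kg gM]] := filter_ex (filterI FK (FM 1%N)).
  rewrite -(subrK (g : 'M_2) M) -addrA; apply: smallD Kg.
  by rewrite -opprB; exact: smallN.
exists (GL2_of (small_unit p_prime M1)); split=> // U /nbhs_GL2P[n sU].
exact: filterS sU (FM n).
Qed.

End Topology.

(** * Finite-dimensional spaces and families of functionals *)

Section FiniteDimension.
Variable k : fieldType.

(** A finite subfamily whose span has maximal dimension spans the whole family. *)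
Lemma finite_spanning_family (vT : vectType k) (T : Type) (f : T -> vT) :
  exists m (s : 'I_m -> T), forall t, exists c : 'I_m -> k, f t = \sum_i c i *: f (s i).
Proof.
suff [s hs] : exists s : seq T, forall t, f t \in <<map f s>>%VS.
  exists (size s), (tnth (in_tuple s)) => t.
  exists (fun i => coord (map_tuple f (in_tuple s)) i (f t)).
  rewrite {1}(coord_span (X := map_tuple f (in_tuple s)) (hs t)); apply: eq_bigr => i _.
  by congr (_ *: _); rewrite -tnth_nth tnth_map.
suff grow d (s : seq T) : (\dim {:vT} - \dim <<map f s>> <= d)%N ->
    exists s : seq T, forall t, f t \in <<map f s>>%VS.
  exact: grow _ [::] (leqnn _).
elim: d s => [|d IH] s hd.
  exists s => t; suff -> : <<map f s>>%VS = fullv by exact: memvf.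
  by apply/eqP; rewrite eqEdim subvf -subn_eq0 -leqn0.
case: (pselect (forall t, f t \in <<map f s>>%VS)) => [|/existsNP[t /negP ft]]; first by exists s.
(* Adding t to the list increases the dimension of the span. *)
apply: (IH (t :: s)); rewrite /= span_cons.
have lt : (\dim <<map f s>> < \dim (<[f t]> + <<map f s>>))%N.
  rewrite ltn_neqAle dimvS ?addvSr // andbT; apply: contra ft => /eqP e.
  have /eqP -> : (<<map f s>> == <[f t]> + <<map f s>>)%VS by rewrite eqEdim addvSr e leqnn.
  by apply: (subvP (addvSl _ _)); exact: memv_line.
rewrite leq_subLR; move: hd; rewrite leq_subLR => /leq_trans; apply.
by rewrite addnS -addSn leq_add2r.
Qed.

(** The functionals embed V into a space of row vectors; preimages of finitely many
    vectors that span the image span V. *)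
Lemma finite_dim_separated (V : lmodType k) (J : finType) (L : J -> V -> k) :
  (forall j, scalar (L j)) -> (forall x, (forall j, L j x = 0) -> x = 0) ->
  finite_dim [set: V].
Proof.
move=> L_lin L_sep; pose f x : 'rV[k]_#|J| := \row_i L (enum_val i) x.
have [m [s hs]] := finite_spanning_family f.
exists (map s (enum 'I_m)); split=> // x _; have [c hc] := hs x.
exists (fun i => if insub i is Some j then c j else 0).
rewrite size_map size_enum_ord.
rewrite (eq_bigr (fun i => c i *: s i)); last first.
  move=> i _; rewrite valK (nth_map i) ?size_enum_ord ?nth_ord_enum //.
apply/eqP; rewrite -subr_eq0; apply/eqP/L_sep => j.
have L0 : L j 0 = 0 by have := L_lin j (-1) 0 0; rewrite scaleN1r addNr mulN1r addNr.
have LB u v : L j (u - v) = L j u - L j v.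
  by have := L_lin j (-1) v u; rewrite scaleN1r mulN1r ![- _ + _]addrC.
have LS : L j (\sum_i c i *: s i) = \sum_i c i * L j (s i).
  elim/big_rec2: _ => // i y1 y2 _ <-; exact: L_lin.
rewrite LB LS; have := congr1 (fun r : 'rV_#|J| => r 0 (enum_rank j)) hc.
rewrite summxE mxE enum_rankK => ->; apply/eqP; rewrite subr_eq0; apply/eqP.
by apply: eq_bigr => i _; rewrite !mxE enum_rankK.
Qed.

(** A functional on A is determined by its row of values on a finite spanning
    family, and finitely many of these rows span all the others. *)
Lemma finite_subfamily (V : lmodType k) (A : set V) (T : Type) (L : T -> V -> k) :
  finite_dim A -> (forall t, scalar (L t)) ->
  exists m (s : 'I_m -> T), forall x, A x ->
    (forall i, L (s i) x = 0) -> forall t, L t x = 0.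
Proof.
move=> [b [_ bA]] L_lin; pose f t : 'rV[k]_(size b) := \row_j L t b`_j.
have [m [s hs]] := finite_spanning_family f.
exists m, s => x /bA[d ->] L0 t; have [c hc] := hs t.
have LS u : L u (\sum_(i < size b) d i *: b`_i) = \sum_(i < size b) d i * L u b`_i.
  have Lu0 : L u 0 = 0 by have := L_lin u (-1) 0 0; rewrite scaleN1r addNr mulN1r addNr.
  elim/big_rec2: _ => // i y1 y2 _ <-; exact: L_lin.
rewrite LS (eq_bigr (fun j : 'I_(size b) => \sum_i c i * (d j * L (s i) b`_j))).
  rewrite exchange_big big1 //= => i _.
  by rewrite -big_distrr /= -LS L0 mulr0.
move=> j _; have := congr1 (fun r : 'rV_(size b) => r 0 j) hc.
rewrite summxE mxE => ->; rewrite mulr_sumr; apply: eq_bigr => i _.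
by rewrite !mxE mulrCA.
Qed.

End FiniteDimension.

(** * Unipotent operators in characteristic p *)

Section Unipotent.
Variables (V : zmodType) (f : {additive V -> V}).

(** Newton's forward difference formula, that is, the binomial expansion of
    (1 + D)^n with D = f - 1. *)
Lemma iter_newton n x :
  iter n f x = \sum_(i < n.+1) iter i (fun y => f y - y) x *+ 'C(n, i).
Proof.
elim: n => [|n IH]; first by rewrite big_ord1.
rewrite iterS IH; set D := fun y => f y - y; set S := fun i => iter i D x.
have fS i : f (S i) = S i + S i.+1 by rewrite /S /= addrC subrK.
have -> : \sum_(i < n.+2) S i *+ 'C(n.+1, i) =
    S 0%N + \sum_(i < n.+1) (S i.+1 *+ 'C(n, i.+1) + S i.+1 *+ 'C(n, i)).
  rewrite big_ord_recl bin0; congr (_ + _).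
  by apply: eq_bigr => i _; rewrite lift0 binS mulrnDr.
have -> : f (\sum_(i < n.+1) S i *+ 'C(n, i)) =
    \sum_(i < n.+1) (S i *+ 'C(n, i) + S i.+1 *+ 'C(n, i)).
  by rewrite raddf_sum; apply: eq_bigr => i _; rewrite raddfMn fS mulrnDl.
rewrite !big_split /= addrA; congr (_ + _).
transitivity (\sum_(i < n.+2) S i *+ 'C(n, i)).
  by rewrite [RHS]big_ord_recr /= (bin_small (ltnSn n)) mulr0n addr0.
by rewrite [LHS]big_ord_recl bin0.
Qed.

(** Put D = f - 1. As p kills V and divides the binomial coefficients C(p, i) for 0 < i < p,
    D^p x = f^p x - x = 0. The last nonzero vector among the D^i x is fixed by f,
    and it lies in Y. *)
Lemma unipotent_fixed (p : nat) (Y : set V) x : prime p ->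
  (forall y : V, y *+ p = 0) -> (forall y, Y y -> Y (f y - y)) ->
  Y x -> x != 0 -> iter p f x = x -> exists y, [/\ Y y, y != 0 & f y = y].
Proof.
move=> p_pr Vp YD Yx x0 fpx; set D := fun y => f y - y.
have Dp : iter p D x = 0.
  case: p p_pr Vp fpx => // q p_pr Vp fpx.
  apply: (addrI x); rewrite addr0 -[RHS]fpx iter_newton.
  rewrite big_ord_recr big_ord_recl /= bin0 binn !mulr1n big1 ?addr0 // => i _.
  have /dvdnP[r ->] : (q.+1 %| 'C(q.+1, lift ord0 i))%N.
    by rewrite prime_dvd_bin // lift0 /= ltnS ltn_ord.
  by rewrite mulrnA Vp.
have ex : exists j, iter j D x == 0 by exists p; rewrite Dp.
case: (ex_minnP ex) => -[|j] /eqP Dj min_j; first by case/eqP: x0.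
exists (iter j D x); split.
- by elim: (j) => // i IH; exact: YD.
- by apply/negP => /min_j; rewrite ltnn.
- by apply/eqP; rewrite -subr_eq0; apply/eqP.
Qed.

End Unipotent.

(** * Finite quotients of congruence subgroups *)

Section CongruenceQuotients.
Variables (p : nat) (p_prime : prime p).
Implicit Types (g h : GL2 p) (m n : nat).
Local Notation K := (@congr_subgroup p).

(** Elements of K_m with the same entries modulo p^n are in the same left coset of
    K_n, so it is enough to choose one element of K_m for each matrix of residues
    that occurs. Residues that do not occur are given the element 1. *)
Lemma congr_transversal m n : (0 < m)%N -> (0 < n)%N ->
  exists (J : finType) (r : J -> GL2 p),
    (forall j, K m (r j)) /\ forall h, K m h -> exists j, K n ((r j)^-1 * h)%g.
Proof.
move=> m0 n0.
pose near (t : 'M['I_(p ^ n)]_2) : set (GL2 p) :=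
  [set h | K m h /\ small n ((h : 'M_2) - \matrix_(i, j) (t i j)%:R)].
have ex t : exists r, K m r /\ forall h, near t h -> near t r.
  case: (pselect (exists h, near t h)) => [[h ht]|no_h].
    by exists h; split=> //; case: ht.
  by exists 1%g; split=> [|h ht]; [exact: congr_subgroup1 | case: no_h; exists h].
pose r t := projT1 (cid (ex t)).
have rP t : K m (r t) /\ forall h, near t h -> near t (r t) := projT2 (cid (ex t)).
exists ('M['I_(p ^ n)]_2 : finType), r; split=> [t|h Kh]; first by case: (rP t).
have K1 g : K m g -> K 1 g by exact: (congr_subgroup_le p_prime m0).
have [t ht] := integral_center p_prime n (congr_subgroup_small0 p_prime (K1 h Kh)).
have [Kr /(_ h (conj Kh ht)) [_ rt]] := rP t.
exists t; apply: (congr_subgroup_div p_prime n0 (K1 _ Kr) (K1 _ Kh)) => i j.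
have := ht i j; have := rt i j; rewrite !mxE => rij hij.
exact: padic_dist_le rij hij.
Qed.

Lemma small_scale_expp e n (A : 'M[Qp p]_2) : small (n + e) (p%:R ^+ e *: A) -> small n A.
Proof.
have p0 : 0 < p%:R :> rat by rewrite ltr0n prime_gt0.
have pe : padic_norm (p%:R ^+ e : Qp p) = p%:R ^- e.
  by rewrite -natrX padic_norm_nat natrX padic_abs_expp.
move=> sA i j; have := sA i j; rewrite mxE padic_normM pe exprD invfM mulrC.
by rewrite ler_pM2r ?invr_gt0 ?exprn_gt0.
Qed.

Lemma small_bounded (A : 'M[Qp p]_2) : exists e, small 0 (p%:R ^+ e *: A).
Proof.
have p0 : 0 < p%:R :> rat by rewrite ltr0n prime_gt0.
have ex i j : exists e, p%:R ^- e * padic_norm (A i j) <= 1.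
  have a0 : 0 < (padic_norm (A i j) + 1)^-1.
    by rewrite invr_gt0 ltr_wpDl ?padic_norm_ge0.
  have [e he] := exprVp_lt p_prime a0; exists e.
  apply: (le_trans (y := (padic_norm (A i j) + 1)^-1 * (padic_norm (A i j) + 1))).
    by rewrite ler_pM ?padic_norm_ge0 ?exprVp_ge0 ?(ltW he) // lerDl.
  by rewrite mulVf // -invr_eq0 gt_eqF.
have [e he] := choice2 ex.
exists (\max_i \max_j e i j) => i j; rewrite mxE padic_normM expr0 invr1.
rewrite -[in padic_norm (_ ^+ _)]natrX padic_norm_nat natrX padic_abs_expp //.
apply: le_trans (he i j); apply: ler_wpM2r; first exact: padic_norm_ge0.
apply: (le_exprVp p_prime).
exact: leq_trans (leq_bigmax j) (leq_bigmax (F := fun i => \max_j e i j) i).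
Qed.

(** If p^a g and p^b g^-1 are integral, then so is p^(a + b) g A g^-1 for every
    integral A; hence conjugation by g costs at most a + b levels. *)
Lemma congr_subgroup_conj n g : exists2 N, (0 < N)%N &
  forall u, K N u -> K n (g * u * g^-1)%g.
Proof.
have [a ga] := small_bounded (g : 'M_2); have [b gb] := small_bounded (GL2_inv g : 'M_2).
exists (n + (a + b)).+1 => // u /(congr_subgroup_le p_prime (leqnSn _)) Ku.
rewrite /K /mkset; apply: (@small_scale_expp (a + b)).
have -> : ((g * u * g^-1)%g : 'M_2) - 1%:M =
    (g : 'M_2) *m ((u : 'M_2) - 1%:M) *m (GL2_inv g : 'M_2).
  rewrite mulmxBr mulmx1 mulmxBl [X in _ = _ - X]mulmxV ?GL2_unit //.
have -> : p%:R ^+ (a + b) *: ((g : 'M_2) *m ((u : 'M_2) - 1%:M) *m (GL2_inv g : 'M_2)) =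
  (p%:R ^+ a *: (g : 'M_2)) *m ((u : 'M_2) - 1%:M) *m (p%:R ^+ b *: (GL2_inv g : 'M_2)).
  by rewrite -scalemxAr -!scalemxAl scalerA addnC exprD.
rewrite -[(n + _)%N]addn0; apply: smallM gb; rewrite -[(n + _)%N]add0n.
exact: smallM ga Ku.
Qed.

End CongruenceQuotients.

(** * Fixed vectors of pro-p groups in characteristic p *)

Section FixedVectors.
Variables (p : nat) (p_prime : prime p) (k : fieldType) (k_char : p%:R = 0 :> k).
Variables (V : rep k (GL2 p)) (X : set V).
Hypothesis XB : forall x y, X x -> X y -> X (x - y).
Local Notation K := (@congr_subgroup p).
Hypothesis XK : forall g x, K 1 g -> X x -> X (act g x).

Lemma act_expg (g : GL2 p) n (x : V) : act (g ^+ n)%g x = iter n (act g) x.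
Proof. by elim: n => [|n IH]; rewrite ?expg0 ?act1 // expgS actM IH. Qed.

(** A finite transversal of K_n modulo K_(n+1) acts on the K_(n+1)-fixed vectors of
    X by commuting operators whose p-th power is 1. They are treated one after the
    other: each preserves the vectors fixed by the previous ones, and has a
    nonzero fixed vector among them by [unipotent_fixed]. *)
Lemma congr_fixed_descent n v : (0 < n)%N ->
  X v -> v != 0 -> (forall c, K n.+1 c -> act c v = v) ->
  exists w, [/\ X w, w != 0 & forall g, K n g -> act g w = w].
Proof.
move=> n0 Xv v0 fv.
have [J [r [Kr cov]]] := congr_transversal p_prime n0 (ltn0Sn n).
suff fix_list (l : seq J) : exists w, [/\ X w, w != 0, forall c, K n.+1 c -> act c w = w
    & {in l, forall j, act (r j) w = w}].
  have [w [Xw w0 fw rw]] := fix_list (enum J).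
  exists w; split=> // g /cov[j Kj].
  have -> : g = (r j * ((r j)^-1 * g))%g by rewrite mulVKg.
  by rewrite actM fw // rw // mem_enum.
elim: l => [|j l [w [Xw w0 fw lw]]]; first by exists v.
pose Y : set V := [set x | [/\ X x, forall c, K n.+1 c -> act c x = x
    & {in l, forall i, act (r i) x = x}]].
have Kn1 g : K n g -> K 1 g by exact: (congr_subgroup_le p_prime n0).
have Yg x : Y x -> Y (act (r j) x).
  move=> [Xx fx lx]; split.
  - exact: XK (Kn1 _ (Kr j)) Xx.
  - move=> c Kc; rewrite -actM.
    have -> : (c * r j = r j * ((r j)^-1 * (c * r j)))%g by rewrite mulVKg.
    rewrite actM fx //; exact: (congr_subgroup_normal p_prime (ltn0Sn n) (Kn1 _ (Kr j)) Kc).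
  - move=> i li; rewrite -actM.
    have [c Kc ->] := congr_subgroup_comm p_prime n0 (Kr i) (Kr j).
    by rewrite !actM fx // lx.
have YB x y : Y x -> Y y -> Y (x - y).
  move=> [Xx fx lx] [Xy fy ly]; split; first exact: XB.
    by move=> c Kc; rewrite linearB /= fx ?fy.
  by move=> i li; rewrite linearB /= lx ?ly.
have [||||| y [[Xy fy ly] y0 jy]] := @unipotent_fixed V (act (r j)) p Y w p_prime.
- by move=> y; rewrite -scaler_nat k_char scale0r.
- by move=> y Yy; apply: YB => //; exact: Yg.
- by [].
- exact: w0.
- by rewrite -act_expg fw //; exact: (congr_subgroup_expp p_prime n0 (Kr j)).
exists y; split=> // i; rewrite inE => /predU1P[-> //|]; exact: ly.
Qed.

Lemma congr_fixed_vector n v : (0 < n)%N ->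
  X v -> v != 0 -> (forall c, K n c -> act c v = v) ->
  exists w, [/\ X w, w != 0 & forall g, K 1 g -> act g w = w].
Proof.
case: n => // n _; elim: n v => [|n IH] v Xv v0 fv; first by exists v.
have [w [Xw w0 fw]] := congr_fixed_descent (ltn0Sn n) Xv v0 fv.
exact: IH fw.
Qed.

End FixedVectors.

Lemma Fpbar_char (p : nat) : prime p -> p%:R = 0 :> Fpbar p.
Proof.
move=> p_prime; rewrite /Fpbar; case: (countable_algebraic_closure _) => K [f _] /=.
by have [_ /eqP] := andP (rmorph_pchar f (pchar_Fp p_prime)).
Qed.

(** * Smooth functionals on admissible representations *)

Section SmoothFunctional.
Variables (p : nat) (p_prime : prime p) (V : rep (Fpbar p) (GL2 p)).
Local Notation K := (@congr_subgroup p).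

Lemma smooth_congr_stabilizer (v : V) : smooth V ->
  exists2 n, (0 < n)%N & forall g, K n g -> act g v = v.
Proof.
move=> /(_ v) o.
have : nbhs (1%g : GL2 p) [set g | act g v = v].
  by apply: open_nbhs_nbhs; split=> //=; exact: act1.
move=> /(nbhs_GL2P p_prime)[n sn]; exists n.+1 => // g.
by move=> /(congr_subgroup_le p_prime (leqnSn n)) Kg; exact: sn Kg.
Qed.

(** The finitely many functionals that separate the points of V are the x |-> lam (s_i r_j x), where the s_i suffice on the
    K_1-fixed vectors and the r_j represent K_1 modulo a small enough K_N. *)
Lemma finite_dim_of_smooth_functional (lam : V -> Fpbar p) n :
  admissible V -> irreducible V -> scalar lam -> (exists x, lam x <> 0) ->
  (forall g x, K n g -> lam (act g x) = lam x) ->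
  finite_dim [set: V].
Proof.
move=> [V_smooth V_adm] [_ V_irr] lam_lin [x0 lam_x0] lam_K.
have lam0 : lam 0 = 0 by have := lam_lin (-1) 0 0; rewrite scaleN1r addNr mulN1r addNr.
have lamB x y : lam (x - y) = lam x - lam y.
  by have := lam_lin (-1) y x; rewrite scaleN1r mulN1r ![- _ + _]addrC.
have act_lin g : scalar (fun x => lam (act g x)).
  by move=> a x y; rewrite linearP lam_lin.
have separating x : (forall g, lam (act g x) = 0) -> x = 0.
  pose S : {pred V} := fun y => `[< forall g, lam (act g y) = 0 >].
  have SP y : reflect (forall g, lam (act g y) = 0) (y \in S) by exact: asboolP.
  move=> /SP xS; case: (V_irr S).
  - split=> [|a y z /SP Sy /SP Sz]; apply/SP => g; first by rewrite linear0.
    by rewrite act_lin Sy Sz mulr0 addr0.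
  - by move=> g y /SP Sy; apply/SP => h; rewrite -actM.
  - by move=> S0; move: xS; rewrite S0 => /eqP.
  - move=> ST; case: lam_x0; have := ST x0; rewrite [RHS]inE => /SP/(_ 1%g).
    by rewrite act1.
have [m [s hs]] := finite_subfamily
  (V_adm (K 1) (congr_subgroup_group p_prime (ltn0Sn 0)) (congr_subgroup_open p_prime (ltn0Sn 0))
    (congr_subgroup_compact p_prime)) act_lin.
have KM g h : K 1 g -> K 1 h -> K 1 (g * h)%g by exact: congr_subgroupM.
(* The largest K_1-stable space on which the functionals lam (s_i x) vanish. *)
pose X : set V := [set x | forall i h, K 1 h -> lam (act (s i * h)%g x) = 0].
have X0 x : X x -> x = 0.
  move=> Xx; apply/eqP; apply: contraT => x_neq0.
  have [N N0 fx] := smooth_congr_stabilizer x V_smooth.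
  have [||w [Xw /eqP w0 fw]] := congr_fixed_vector p_prime (Fpbar_char p_prime)
    (X := X) _ _ N0 Xx x_neq0 fx.
  - by move=> y z Xy Xz i h Kh; rewrite linearB lamB Xy ?Xz ?subrr.
  - by move=> g y Kg Xy i h Kh; rewrite -actM -mulgA Xy //; exact: KM.
  case: w0; apply: separating; apply: hs; first exact: fw.
  by move=> i; rewrite -[s i]mulg1; apply: Xw; exact: congr_subgroup1.
(* For h = u r_j with u in K_N, lam (s_i h x) = lam (s_i r_j x), provided that
   conjugation by s_i carries K_N into the group K_n which fixes lam. *)
have exN i : exists N, (0 < N)%N /\ forall u, K N u -> K n (s i * u * (s i)^-1)%g.
  by have [N N0 hN] := congr_subgroup_conj p_prime n (s i); exists N.
have [N hN] : exists N : 'I_m -> nat, forall i,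
    (0 < N i)%N /\ forall u, K (N i) u -> K n (s i * u * (s i)^-1)%g.
  by exists (fun i => projT1 (cid (exN i))) => i; exact: projT2 (cid (exN i)).
have [J [r [Kr cov]]] := congr_transversal p_prime (ltn0Sn 0) (ltn0Sn (\max_i N i)).
apply: (@finite_dim_separated _ V ('I_m * J)%type (fun ij x => lam (act (s ij.1 * r ij.2)%g x))).
  by move=> ij; exact: act_lin.
move=> x Lx; apply: X0 => i h Kh; have [j Kj] := cov h Kh.
rewrite -(Lx (i, j)) /=.
have Kc : K (N i) (h * (r j)^-1)%g.
  apply: (congr_subgroup_le p_prime (leq_trans (leq_bigmax i) (leqnSn (\max_i N i)))).
  have := congr_subgroup_normal p_prime (ltn0Sn _) (congr_subgroupV p_prime (ltn0Sn 0) (Kr j)) Kj.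
  by rewrite invgK -mulgA mulVKg.
have -> : (s i * h = s i * (h * (r j)^-1) * (s i)^-1 * (s i * r j))%g.
  by rewrite !mulgA mulgVK mulgVK.
by rewrite actM (lam_K _ _ ((hN i).2 _ Kc)).
Qed.

End SmoothFunctional.

Theorem corollary1p4 (p : nat) (p_prime : prime p)
    (n : nat) (n_gt0 : (0 < n)%N)
    (pi : 'I_n -> rep (Fpbar p) (GL2 p))
    (pi_inf : forall i, ~ finite_dim [set: pi i])
    (pi_adm : forall i, admissible (pi i))
    (pi_irr : forall i, irreducible (pi i)) :
  HomG (tensor_rep pi) (triv_rep (Fpbar p) (GL2 p)) = [set fun=> 0].
Proof.
apply/seteqP; split=> [f [f_lin f_G]|_ ->]; last first.
  by split=> [a x y|g v] /=; rewrite ?scaler0 ?addr0.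
apply/funext => t /=; apply: contrapT => ft.
have [v fv] : exists v, f (tens v) <> 0.
  apply: contrapT => /forallNP f0; apply: ft; have [s ->] := tensor_span t.
  have f00 : f 0 = 0 by have := f_lin (-1) 0 0; rewrite !scaleN1r !addNr.
  elim: s => [|z s IH]; first by rewrite big_nil.
  by rewrite big_cons f_lin IH addr0 (contrapT (f0 z.2)) scaler0.
pose i0 := Ordinal n_gt0.
(* Equivariance of f moves g from x to the other factors of v, which a small
   enough congruence subgroup fixes; so lam is smooth. *)
pose lam (x : pi i0) : Fpbar p := f (tens (dfwith v i0 x)).
have [N hN] : exists N : 'I_n -> nat, forall i g, congr_subgroup (N i) g -> act g (v i) = v i.
  have ex i : exists N, forall g, congr_subgroup N g -> act g (v i) = v i.
    by have [N _ hN] := smooth_congr_stabilizer p_prime (v i) (pi_adm i).1; exists N.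
  by exists (fun i => projT1 (cid (ex i))) => i; exact: projT2 (cid (ex i)).
apply: (pi_inf i0).
apply: (@finite_dim_of_smooth_functional _ p_prime _ lam (\max_i N i)) => //.
- by move=> a x y; rewrite /lam tens_multilinear f_lin.
- exists (v i0); rewrite /lam; suff -> : dfwith v i0 (v i0) = v by [].
  by apply: functional_extensionality_dep => i; case: dfwithP.
- move=> g x Kg; rewrite /lam -[RHS](f_G g) /= tensor_act_tens; congr (f (tens _)).
  apply: functional_extensionality_dep => i.
  case: dfwithP => [|i' ii']; first by rewrite dfwithin.
  by rewrite dfwithout // (hN i') //; exact: (congr_subgroup_le p_prime (leq_bigmax i')) Kg.
Qed.
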